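(* Let $t>0$, and consider any coordination of the appliances over the time interval $[0,t]$ following a demand reduction request issued at time $0$, that is, any choice of admissible ON/OFF controls $u_y:[0,t]\to\{0,1\}$ for $y\in[0,L]$, where the aggregated consumption is not required to be constant over $[0,t]$. Then the relative reduced power over the duration $t$ with respect to the stationary consumption, $$R = 1-\frac{1}{t\,P_{\mathrm{tot}}}\int_0^t \frac{NP}{L}\int_0^L u_y(\tau)\,dy\,d\tau ,$$ cannot exceed $$R_{\sup}(t) := \max\left(1-\frac{wt}{2\Delta},\ \frac{\Delta}{2wt}\right),$$ i.e. $R\le R_{\sup}(t)$.
   Context: Let $\Delta,v,w,P,N>0$ be constants. There is a large number $N$ of identical appliances, treated as a continuum. Each appliance has to keep a temperature within an interval $[T_{\min},T_{\max}]$ of length $\Delta=T_{\max}-T_{\min}$ by means of a temperature modifier that is either ON (consuming power $P$) or OFF (consuming no power). Call ''drift limit'' the end of the interval towards which the temperature drifts when the modifier is OFF ($T_{\max}$ for a cooling appliance, $T_{\min}$ for a heating appliance), and let $\delta\in[0,\Delta]$ be the distance between the current temperature and the drift limit. When the modifier is ON, $\delta$ increases at constant speed $v$; when it is OFF, $\delta$ decreases at constant speed $w$. Nominal behavior (no request): the modifier is switched ON when $\delta$ reaches $0$, stays ON until $\delta=\Delta$ (duration $\Delta/v$), then is OFF until $\delta=0$ (duration $\Delta/w$), and so on periodically; the cycle length is $L:=\Delta/v+\Delta/w$. The position of an appliance is the time $y\in[0,L]$ elapsed, at time $0$, since the beginning of its current cycle (the last nominal switching to ON). Thus at time $0$ the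 distance of an appliance of position $y$ to the drift limit is $\delta_0(y)=vy$ if $0\le y\le\Delta/v$ and $\delta_0(y)=\Delta-w(y-\Delta/v)$ if $\Delta/v\le y\le L$. Standing assumption: when the request is issued (time $0$), the positions $y$ of the appliances are uniformly distributed over $[0,L]$. Without any request, the aggregated consumption is then constant over time and equal to $P_{\mathrm{tot}}=NP\frac{w}{v+w}$ (stationary consumption). Controls: a family $(u_y)_{y\in[0,L]}$ of functions $u_y:[0,t]\to\{0,1\}$, jointly measurable in $(y,\tau)$, where $u_y(\tau)=1$ means that the appliance of position $y$ is ON at time $\tau$. The family is admissible if the temperature constraint is satisfied by every appliance: $0\le \delta_0(y)+\int_0^\tau\big(v\,u_y(s)-w(1-u_y(s))\big)\,ds\le\Delta$ for all $\tau\in[0,t]$ and all $y\in[0,L]$. *)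

(* Defs.v *)
From HB Require Import structures.
From mathcomp Require Import all_boot all_order all_algebra.
From mathcomp Require Import all_classical all_reals all_analysis.
Import Order.TTheory GRing.Theory Num.Theory.
Import numFieldNormedType.Exports.

Set Implicit Arguments.
Unset Strict Implicit.
Unset Printing Implicit Defensive.

Local Open Scope classical_set_scope.
Local Open Scope ring_scope.

Section Appliances.
Context {R : realType}.

(* Width of the temperature interval; speeds of the distance to the drift
   limit when the modifier is ON (increasing, v) and OFF (decreasing, w);
   power of one appliance; number of appliances. As the appliances are treated
   as a continuum, N is a real number. *)
Variables (Delta v w P N : R).

Definition cycle_length : R := Delta / v + Delta / w.

Definition initial_distance (y : R) : R :=
  if y <= Delta / v then v * y else Delta - w * (y - Delta / v).

Definition stationary_consumption : R := N * P * (w / (v + w)).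

(* A family of controls over the horizon t is a total function u of the
   position and of the time; every definition below only reads its values on
   [0, cycle_length] x [0, t]. *)
Variables (t : R) (u : R -> R -> bool).

(* Joint measurability, for the product of the Borel sigma-algebras. *)
Definition jointly_measurable : Prop :=
  measurable_fun (`[0, cycle_length] `*` `[0, t])
    (fun p : R * R => u p.1 p.2).

Definition distance (y tau : R) : R :=
  initial_distance y +
  \int[lebesgue_measure]_(s in `[0, tau])
    (v * (u y s)%:R - w * (1 - (u y s)%:R)).

Definition admissible : Prop :=
  forall y tau : R, 0 <= y <= cycle_length -> 0 <= tau <= t ->
    0 <= distance y tau <= Delta.

Definition aggregated_consumption (tau : R) : R :=
  N * P / cycle_length *
  \int[lebesgue_measure]_(y in `[0, cycle_length]) (u y tau)%:R.

Definition relative_reduced_power : R :=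
  1 - 1 / (t * stationary_consumption) *
      \int[lebesgue_measure]_(tau in `[0, t]) aggregated_consumption tau.

Definition R_sup : R :=
  Num.max (1 - w * t / (2 * Delta)) (Delta / (2 * w * t)).

End Appliances.

(* Main.v *)
Require Import Defs.
From HB Require Import structures.
From mathcomp Require Import all_boot all_order all_algebra.
From mathcomp Require Import all_classical all_reals all_analysis.
From mathcomp Require Import ring lra.
Import Order.TTheory GRing.Theory Num.Theory.
Import numFieldNormedType.Exports.

Local Open Scope classical_set_scope.
Local Open Scope ring_scope.

(** An appliance that is ON for a total time [S] during the horizon ends at the
    distance [delta0 + (v + w) * S - w * t] from the drift limit, where [delta0]
    is its initial distance. Admissibility makes this nonnegative, so that
    [S >= (w * t - delta0) / (v + w)]: an appliance can be OFF only as long as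
    its initial distance allows ([on_time_ge]).

    Along the nominal cycle the distance runs through two linear ramps between
    [0] and [Delta], each of mean [Delta / 2]; its mean over the uniformly
    distributed positions is therefore [Delta / 2]
    ([Rintegral_initial_distance]). Hence the mean of [S] over the positions is
    at least [(w * t - Delta / 2) / (v + w)]. By Fubini
    ([Rintegral_aggregated_consumption]) this bounds the consumed energy from
    below, and the bound reads [R <= Delta / (2 * w * t)].

    This is the second term of the maximum, and it is the maximum: with
    [x = w * t / Delta] the two terms are [1 - x / 2] and [1 / (2 * x)], and the
    second minus the first is [(x - 1) ^ 2 / (2 * x) >= 0]. *)

(** * Fubini for real-valued integrals over a rectangle *)

Section rectangle_Fubini.
Context {d1 d2 : measure_display} {T1 : measurableType d1}
  {T2 : measurableType d2} {R : realType}.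
Variables (m1 : {sigma_finite_measure set T1 -> \bar R})
  (m2 : {sigma_finite_measure set T2 -> \bar R}).
Variables (D1 : set T1) (D2 : set T2) (f : T1 -> T2 -> R).
Hypotheses (mD1 : measurable D1) (mD2 : measurable D2).
Hypotheses (finD1 : (m1 D1 < +oo)%E) (finD2 : (m2 D2 < +oo)%E).
Hypothesis mf : measurable_fun (D1 `*` D2) (fun p => f p.1 p.2).
Hypothesis bf : [bounded f p.1 p.2 | p in D1 `*` D2].

Lemma integrable_section1 x : D1 x -> m2.-integrable D2 (EFin \o f x).
Proof.
move=> D1x; apply: measurable_bounded_integrable => //.
- apply: (measurable_comp (f := fun p => f p.1 p.2) (F := D1 `*` D2)
    (g := pair x)) => //.
  + exact: measurableX.
  + by move=> _ [y D2y <-].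
  + exact: measurable_funTS.
- case: bf => M [Mreal fM]; exists M; split => // r Mr y D2y.
  exact: (fM r Mr (x, y)).
Qed.

Lemma integrable_section2 y : D2 y -> m1.-integrable D1 (EFin \o f ^~ y).
Proof.
move=> D2y; apply: measurable_bounded_integrable => //.
- apply: (measurable_comp (f := fun p => f p.1 p.2) (F := D1 `*` D2)
    (g := fun x => (x, y))) => //.
  + exact: measurableX.
  + by move=> _ [x D1x <-].
  + exact: measurable_funTS.
- case: bf => M [Mreal fM]; exists M; split => // r Mr x D1x.
  exact: (fM r Mr (x, y)).
Qed.

(* Extending [f] by zero outside the rectangle reduces the statements to the
   whole product space; since the sections of [f] over the rectangle are all
   integrable, the extended-real partial integrals of the extension are finite
   at every point, and not only almost everywhere. *)
Let g := (fun p => f p.1 p.2) \_ (D1 `*` D2).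

Let integrable_g : (m1 \x m2)%E.-integrable setT (EFin \o g).
Proof.
rewrite /g -restrict_EFin; apply/(integrable_mkcond _ (measurableX mD1 mD2)).
apply: measurable_bounded_integrable => //; first exact: measurableX.
rewrite [X in (X < _)%E](product_measure1E m1 m2 mD1 mD2).
apply: lte_mul_pinfty => //.
by rewrite ge0_fin_numE.
Qed.

Let fubini_gF : fubini_F m2 (EFin \o g) =
  EFin \o ((fun x => \int[m2]_(y in D2) f x y) \_ D1).
Proof.
apply/funext => x /=; rewrite /fubini_F/= patchE; case: ifPn => D1x.
  rewrite /Rintegral fineK; last first.
    by apply: integrable_fin_num => //; exact: integrable_section1 (set_mem _).
  rewrite [RHS]integral_mkcond; apply: eq_integral => y _.
  by rewrite restrict_EFin/= /g !patchE in_setX/= D1x.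
by apply: integral0_eq => y _; rewrite /g patchE in_setX (negbTE D1x).
Qed.

Let fubini_gG : fubini_G m1 (EFin \o g) =
  EFin \o ((fun y => \int[m1]_(x in D1) f x y) \_ D2).
Proof.
apply/funext => y /=; rewrite /fubini_G/= patchE; case: ifPn => D2y.
  rewrite /Rintegral fineK; last first.
    by apply: integrable_fin_num => //; exact: integrable_section2 (set_mem _).
  rewrite [RHS]integral_mkcond; apply: eq_integral => x _.
  by rewrite restrict_EFin/= /g !patchE in_setX/= D2y andbT.
by apply: integral0_eq => x _; rewrite /g patchE in_setX (negbTE D2y) andbF.
Qed.

Lemma integrable_Rintegral1 :
  m1.-integrable D1 (EFin \o (fun x => \int[m2]_(y in D2) f x y)).
Proof.
apply/(integrable_mkcond _ mD1); rewrite restrict_EFin -fubini_gF.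
exact: integrable_fubini_F.
Qed.

Lemma Rintegral_exchange :
  \int[m1]_(x in D1) \int[m2]_(y in D2) f x y =
  \int[m2]_(y in D2) \int[m1]_(x in D1) f x y.
Proof.
rewrite [LHS]Rintegral_mkcond [RHS]Rintegral_mkcond; congr fine.
have -> : (fun x => (((fun x => \int[m2]_(y in D2) f x y) \_ D1) x)%:E) =
  fubini_F m2 (EFin \o g) by rewrite fubini_gF.
have -> : (fun x => (((fun y => \int[m1]_(x in D1) f x y) \_ D2) x)%:E) =
  fubini_G m1 (EFin \o g) by rewrite fubini_gG.
exact: (Fubini integrable_g).
Qed.

End rectangle_Fubini.

Lemma integrable_Rintegral2 {d1 d2 : measure_display}
    {T1 : measurableType d1} {T2 : measurableType d2} {R : realType}
    (m1 : {sigma_finite_measure set T1 -> \bar R})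
    (m2 : {sigma_finite_measure set T2 -> \bar R})
    (D1 : set T1) (D2 : set T2) (f : T1 -> T2 -> R) :
  measurable D1 -> measurable D2 -> (m1 D1 < +oo)%E -> (m2 D2 < +oo)%E ->
  measurable_fun (D1 `*` D2) (fun p => f p.1 p.2) ->
  [bounded f p.1 p.2 | p in D1 `*` D2] ->
  m2.-integrable D2 (EFin \o (fun y => \int[m1]_(x in D1) f x y)).
Proof.
move=> mD1 mD2 finD1 finD2 mf bf.
apply: (integrable_Rintegral1 m2 m1 D2 D1 (fun y x => f x y)) => //.
- apply: (measurable_comp (f := fun p => f p.1 p.2) (F := D1 `*` D2)
    (g := fun p => (p.2, p.1))) => //.
  + exact: measurableX.
  + by move=> _ [p [D2p D1p] <-].
  + by apply: measurable_funTS; exact: measurable_fun_pair.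
- case: bf => M [Mreal fM]; exists M; split => // r Mr p [D2p D1p].
  exact: (fM r Mr (p.2, p.1) (conj D1p D2p)).
Qed.

(** * Mean initial distance to the drift limit *)

Lemma Rintegral_cst_itv {R : realType} (a b r : R) : a <= b ->
  \int[lebesgue_measure]_(_ in `[a, b]) r = r * (b - a).
Proof.
move=> ab; rewrite Rintegral_cst//=; congr (_ * _).
rewrite lebesgue_measure_itv/= lte_fin; case: ltP => [//|ba].
by rewrite (le_anti (introT andP (conj ab ba))) subrr.
Qed.

(** Written as the length times the value at the midpoint, so that the mean of a
    ramp is read off at once. *)
Lemma Rintegral_affine {R : realType} (a b c k : R) : a < b ->
  \int[lebesgue_measure]_(x in `[a, b]) (c + k * x) =
  (b - a) * (c + k * ((a + b) / 2)).
Proof.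
move=> ab; pose F (x : R) := c * x + k / 2 * x ^+ 2.
have dF (x : R) : is_derive x 1 F (c + k * x).
  apply: is_derive_eq; rewrite /GRing.scale/=; lra.
have cF : continuous F.
  by move=> x; apply/differentiable_continuous/derivable1_diffP.
rewrite /Rintegral (@continuous_FTC2 _ _ F)//=.
- rewrite /F; lra.
- apply: continuous_subspaceT => x.
  by apply: cvgD; [exact: cvg_cst|apply: cvgM; [exact: cvg_cst|exact: cvg_id]].
- split.
  + by move=> x _.
  + by apply: cvg_at_right_filter; exact: cF.
  + by apply: cvg_at_left_filter; exact: cF.
- by move=> x _; rewrite derive1E derive_val.
Qed.

Section initial_distance.
Context {R : realType}.
Variables (Delta v w : R).
Hypotheses (Delta_gt0 : 0 < Delta) (v_gt0 : 0 < v) (w_gt0 : 0 < w).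

(** The two branches, one increasing and one decreasing, cross at [Delta / v], so
    that the definition always selects the lower one. In this form the function
    is visibly continuous, hence integrable on segments. *)
Lemma initial_distance_min : initial_distance Delta v w =
  (fun y => v * y) \min (fun y => Delta - w * (y - Delta / v)).
Proof.
apply/funext => y; rewrite /initial_distance/=.
case: (leP y (Delta / v)) => [yD|Dy]; apply/esym.
- rewrite min_l//; have : v * y <= Delta by rewrite mulrC -ler_pdivlMr.
  have : w * (y - Delta / v) <= 0 by rewrite pmulr_rle0// subr_le0.
  lra.
- rewrite min_r//; have : Delta <= v * y.
    by rewrite mulrC -ler_pdivrMr// ltW.
  have : 0 <= w * (y - Delta / v) by rewrite pmulr_rge0// subr_ge0 ltW.
  lra.
Qed.

Lemma integrable_initial_distance (a b : R) :
  lebesgue_measure.-integrable `[a, b] (EFin \o initial_distance Delta v w).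
Proof.
apply: continuous_compact_integrable; first exact: segment_compact.
rewrite initial_distance_min; apply: continuous_subspaceT => x.
apply: continuous_min.
- by apply: cvgM; [exact: cvg_cst|exact: cvg_id].
- apply: cvgB; first exact: cvg_cst.
  apply: cvgM; first exact: cvg_cst.
  by apply: cvgB; [exact: cvg_id|exact: cvg_cst].
Qed.

Lemma Rintegral_initial_distance :
  \int[lebesgue_measure]_(y in `[0, cycle_length Delta v w])
    initial_distance Delta v w y =
  cycle_length Delta v w * (Delta / 2).
Proof.
set m := Delta / v; set L := cycle_length Delta v w.
have m_gt0 : 0 < m by exact: divr_gt0.
have Lm : L = m + Delta / w by [].
have mL : m < L by rewrite Lm ltrDl divr_gt0.
have vm : v * m = Delta by rewrite /m mulrC divfK// gt_eqF.
have wLm : w * (L - m) = Delta.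
  by rewrite Lm addrAC subrr add0r mulrC divfK// gt_eqF.
have := @Rintegral_itvB _ (initial_distance Delta v w) (BLeft 0) (BRight L) m
  (integrable_initial_distance 0 L).
rewrite !bnd_simp => /(_ (ltW m_gt0) (ltW mL)) /eqP.
rewrite subr_eq => /eqP ->.
rewrite Rintegral_itv_obnd_cbnd; last first.
  apply: integrableS (integrable_initial_distance m L) => //.
  exact: subset_itv_oc_cc.
have -> : \int[lebesgue_measure]_(y in `[0, m]) initial_distance Delta v w y =
    \int[lebesgue_measure]_(y in `[0, m]) (0 + v * y).
  apply: eq_Rintegral => y; rewrite inE/= in_itv/= => /andP[_ ym].
  by rewrite /initial_distance ym add0r.
have -> : \int[lebesgue_measure]_(y in `[m, L]) initial_distance Delta v w y =
    \int[lebesgue_measure]_(y in `[m, L]) ((Delta + w * m) + - w * y).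
  apply: eq_Rintegral => y; rewrite inE/= in_itv/= => /andP[my _].
  rewrite initial_distance_min//= min_r; first by rewrite -/m; ring.
  have : Delta <= v * y by rewrite -vm ler_pM2l.
  have : 0 <= w * (y - m) by rewrite pmulr_rge0// subr_ge0.
  rewrite -/m; lra.
rewrite !Rintegral_affine//.
(* Both ramps join 0 and Delta, so each takes the value Delta / 2 at the middle
   of its segment. *)
have -> : 0 + v * ((0 + m) / 2) = Delta / 2 by rewrite -vm; field.
have -> : Delta + w * m + - w * ((m + L) / 2) = Delta / 2.
  by rewrite -[X in X + _ + _ = _]wLm -[in RHS]wLm; field.
by field.
Qed.

End initial_distance.

(** * Lower bound on the ON times *)

Section on_time.
Context {R : realType}.
Variables (Delta v w t : R) (u : R -> R -> bool).
Hypotheses (Delta_gt0 : 0 < Delta) (v_gt0 : 0 < v) (w_gt0 : 0 < w).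
Hypothesis t_gt0 : 0 < t.
Hypothesis u_meas : jointly_measurable Delta v w t u.

Local Notation L := (cycle_length Delta v w).
Local Notation mu := (@lebesgue_measure R).

Definition on_time (y : R) : R := \int[mu]_(s in `[0, t]) (u y s)%:R.

Lemma cycle_length_gt0 : 0 < L.
Proof. by rewrite addr_gt0// divr_gt0. Qed.

Let mu_itv (a b : R) : (mu `[a, b] < +oo)%E.
Proof.
by rewrite /= lebesgue_measure_itv/=; case: ifP => _; rewrite -?EFinB ltry.
Qed.

Let u_meas_real :
  measurable_fun (`[0, L] `*` `[0, t]) (fun p : R * R => (u p.1 p.2)%:R : R).
Proof. exact: (measurableT_comp (f := fun b : bool => b%:R : R)). Qed.

Let u_bounded : [bounded (u p.1 p.2)%:R : R^o | p in `[0, L] `*` `[0, t]].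
Proof.
exists 1; split => // r r1 p _ /=.
by rewrite (le_trans _ (ltW r1))//; case: (u _ _); rewrite ?normr1 ?normr0.
Qed.

Lemma integrable_control_time (y : R) : 0 <= y <= L ->
  mu.-integrable `[0, t] (EFin \o (fun s => (u y s)%:R : R)).
Proof.
move=> yL; apply: (integrable_section1 mu `[0, L] `[0, t]
  (fun y s => (u y s)%:R : R)) => //.
exact: mu_itv.
Qed.

Lemma integrable_on_time : mu.-integrable `[0, L] (EFin \o on_time).
Proof.
by apply: (integrable_Rintegral1 mu mu _ _ (fun y s => (u y s)%:R)) => //;
  exact: mu_itv.
Qed.

Lemma integrable_on_positions : mu.-integrable `[0, t]
  (EFin \o (fun s => \int[mu]_(y in `[0, L]) (u y s)%:R)).
Proof.
by apply: (integrable_Rintegral2 mu mu `[0, L] `[0, t]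
  (fun y s => (u y s)%:R)) => //; exact: mu_itv.
Qed.

Let integrable_cst (a b r : R) : mu.-integrable `[a, b] (EFin \o cst r).
Proof.
apply: measurable_bounded_integrable => //; first exact: mu_itv.
exact: bounded_cst.
Qed.

(** The speed is [v] when ON and [- w] when OFF, that is [(v + w) * u - w], so
    the final distance depends on the control through its ON time only. *)
Lemma distance_horizon (y : R) : 0 <= y <= L ->
  distance Delta v w u y t =
  initial_distance Delta v w y + ((v + w) * on_time y - w * t).
Proof.
move=> yL; have iu := integrable_control_time y yL.
rewrite /distance; congr (_ + _).
have -> : \int[mu]_(s in `[0, t]) (v * (u y s)%:R - w * (1 - (u y s)%:R)) =
    \int[mu]_(s in `[0, t]) ((v + w) * (u y s)%:R - w).
  by apply: eq_Rintegral => s _; ring.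
rewrite RintegralB//=; last 2 first.
- exact: (integrableZl _ _ iu).
- exact: integrable_cst.
by rewrite RintegralZl// Rintegral_cst_itv ?subr0// ltW.
Qed.

Lemma on_time_ge (y : R) : admissible Delta v w t u -> 0 <= y <= L ->
  (v + w)^-1 * (w * t - initial_distance Delta v w y) <= on_time y.
Proof.
move=> adm yL; have vw_gt0 : 0 < v + w by rewrite addr_gt0.
have /andP[+ _] : 0 <= distance Delta v w u y t <= Delta.
  by apply: adm => //; rewrite lexx ltW.
by rewrite distance_horizon// ler_pdivrMl// => ?; lra.
Qed.

Lemma Rintegral_on_time_ge : admissible Delta v w t u ->
  (v + w)^-1 * (L * (w * t - Delta / 2)) <= \int[mu]_(y in `[0, L]) on_time y.
Proof.
move=> adm; have L_gt0 := cycle_length_gt0.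
have i0 := integrable_initial_distance Delta v w v_gt0 w_gt0 0 L.
have iB : mu.-integrable `[0, L]
    (EFin \o (fun y => w * t - initial_distance Delta v w y)).
  exact: (integrableB _ (integrable_cst 0 L (w * t)) i0).
have -> : (v + w)^-1 * (L * (w * t - Delta / 2)) = \int[mu]_(y in `[0, L])
    ((v + w)^-1 * (w * t - initial_distance Delta v w y)).
  rewrite RintegralZl// RintegralB//; last exact: integrable_cst.
  rewrite Rintegral_cst_itv ?ltW// Rintegral_initial_distance//.
  by congr (_ * _); ring.
apply: le_Rintegral => //.
- exact: (integrableZl _ _ iB).
- exact: integrable_on_time.
- by move=> y /=; rewrite in_itv/= => yL; exact: on_time_ge.
Qed.

Lemma Rintegral_aggregated_consumption (P N : R) :
  \int[mu]_(s in `[0, t]) aggregated_consumption Delta v w P N u s =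
  N * P / L * \int[mu]_(y in `[0, L]) on_time y.
Proof.
rewrite /aggregated_consumption RintegralZl//; last exact: integrable_on_positions.
congr (_ * _); apply/esym.
by apply: (Rintegral_exchange mu mu `[0, L] `[0, t]
  (fun y s => (u y s)%:R)) => //; exact: mu_itv.
Qed.

End on_time.

Theorem proposition1 (R : realType) (Delta v w P N : R)
    (Delta_gt0 : 0 < Delta) (v_gt0 : 0 < v) (w_gt0 : 0 < w)
    (P_gt0 : 0 < P) (N_gt0 : 0 < N)
    (t : R) (t_gt0 : 0 < t) (u : R -> R -> bool)
    (u_meas : jointly_measurable Delta v w t u)
    (u_adm : admissible Delta v w t u) :
  relative_reduced_power Delta v w P N t u <= R_sup Delta w t.
Proof.
have L_gt0 : 0 < cycle_length Delta v w by exact: cycle_length_gt0.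
have vw_gt0 : 0 < v + w by rewrite addr_gt0.
rewrite /R_sup le_max; apply/orP; right.
rewrite /relative_reduced_power Rintegral_aggregated_consumption//.
have := Rintegral_on_time_ge Delta v w t u Delta_gt0 v_gt0 w_gt0 t_gt0
  u_meas u_adm.
set S := \int[_]_(_ in _) _; rewrite /stationary_consumption.
set L := cycle_length _ _ _ in L_gt0 *; move=> S_ge.
(* [N * P] cancels, so both sides compare through the ON time alone: [S] against
   its lower bound. *)
have -> : 1 / (t * (N * P * (w / (v + w)))) * (N * P / L * S) =
    (v + w) / (t * w * L) * S.
  by field; rewrite !gt_eqF.
have -> : Delta / (2 * w * t) =
    1 - (v + w) / (t * w * L) * ((v + w)^-1 * (L * (w * t - Delta / 2))).
  by field; rewrite !gt_eqF.
by rewrite lerD2l lerN2 ler_wpM2l// divr_ge0// ?mulr_ge0// ltW.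
Qed.
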